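(* Let $(a,b)\in\mathcal H_{\mathrm{III}}$, suppose $a$ is a square in $K$, and let $\phi=\phi_{a,b}$. There exists a homeomorphism $\omega:\{\pm\}^{\mathbb Z}\to J(\phi)$ such that $\omega\circ\sigma=\phi\circ\omega$.
   Context: $K$ is a field complete and locally compact with respect to a nontrivial non-Archimedean absolute value $|\cdot|$, whose residue field has odd characteristic. $\mathcal H_{\mathrm{III}}=\{(a,b)\in K^2: b\neq0,\ |a|>\max(1,|b|^2)\}$, $\phi_{a,b}(x,y)=(a+by-x^2,x)$, a bijection of $K^2$ with inverse $(x,y)\mapsto(y,\frac1b(-a+x+y^2))$. $J(\phi)$ is the set of $(x,y)\in K^2$ whose two-sided orbit $\{\phi^n(x,y):n\in\mathbb Z\}$ is bounded for the norm $\max(|x|,|y|)$, with the subspace topology from $K^2$. $\{\pm\}^{\mathbb Z}$ is the set of bisequences $s=(s_k)_{k\in\mathbb Z}$ with $s_k\in\{+,-\}$, with metric $d(s,s')=e^{-\min\{|k|:s_k\ne s'_k\}}$, and $\sigma:\{\pm\}^{\mathbb Z}\to\{\pm\}^{\mathbb Z}$ is the shift $\sigma(s)_k=s_{k+1}$. *)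

(* Defs.v *)
From HB Require Import structures.
From mathcomp Require Import all_boot all_order all_algebra.
From mathcomp Require Import all_classical all_reals all_analysis.
From mathcomp Require Import ring.

Set Implicit Arguments.
Unset Strict Implicit.
Unset Printing Implicit Defensive.

Import Order.TTheory GRing.Theory Num.Theory.

Local Open Scope classical_set_scope.
Local Open Scope ring_scope.

Record nonarch_absv (R : realType) (K : fieldType) := NonarchAbsv {
  absv :> K -> R ;
  absv_ge0 : forall x, 0 <= absv x ;
  absv_eq0 : forall x, (absv x == 0) = (x == 0) ;
  absvM : forall x y, absv (x * y) = absv x * absv y ;
  absvD : forall x y, absv (x + y) <= Num.max (absv x) (absv y)
}.

Definition nontrivial_absv (R : realType) (K : fieldType)
    (v : nonarch_absv R K) :=
  exists x, x != 0 /\ v x != 1.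

Section absv_theory.
Context {R : realType} {K : fieldType} (v : nonarch_absv R K).
Implicit Types x y : K.

Lemma absv0 : v 0 = 0.
Proof. by apply/eqP; rewrite absv_eq0. Qed.

Lemma absv1 : v 1 = 1.
Proof.
have n0 : v 1 != 0 by rewrite absv_eq0 oner_eq0.
by apply: (mulfI n0); rewrite -absvM !mulr1.
Qed.

Lemma absvN x : v (- x) = v x.
Proof.
have /eqP : v (-1) ^+ 2 = 1 by rewrite expr2 -absvM mulrNN mulr1 absv1.
rewrite sqrf_eq1 => /orP[] /eqP N1; first by rewrite -mulN1r absvM N1 mul1r.
by have := absv_ge0 v (-1); rewrite N1 oppr_ge0 ler10.
Qed.

Lemma absvV x : v x^-1 = (v x)^-1.
Proof.
have [->|x0] := eqVneq x 0; first by rewrite invr0 absv0 invr0.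
have n0 : v x != 0 by rewrite absv_eq0.
by apply: (mulfI n0); rewrite -absvM !divff// absv1.
Qed.

End absv_theory.

(* K with the metric, hence the uniform structure and the topology, given by
   the absolute value v. *)
Definition valued {R : realType} {K : fieldType} (v : nonarch_absv R K) : Type :=
  K.

Section valued_metric.
Context {R : realType} {K : fieldType} (v : nonarch_absv R K).

HB.instance Definition _ := GRing.Field.on (valued v).

Let dist (x y : valued v) : R := v (x - y).

Let distxx x : dist x x = 0.
Proof. by rewrite /dist subrr absv0. Qed.

Let dist_positivity x y : dist x y = 0 -> x = y.
Proof. by move=> /eqP; rewrite absv_eq0 subr_eq0 => /eqP. Qed.

Let dist_sym x y : dist x y = dist y x.
Proof. by rewrite /dist -(absvN v) opprB. Qed.

Let dist_triangle y x z : dist x z <= dist x y + dist y z.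
Proof.
rewrite /dist -(subrKA y x (- z)) (le_trans (absvD v _ _))// ge_max.
by rewrite lerDl lerDr !absv_ge0.
Qed.

HB.instance Definition _ := isMetric.Build R (valued v)
  distxx dist_positivity dist_sym dist_triangle.
HB.instance Definition _ := isPointed.Build (valued v) 0.

Lemma mdist_valued (x y : valued v) : mdist x y = v (x - y).
Proof. by []. Qed.

End valued_metric.

Definition complete_absv (R : realType) (K : fieldType)
    (v : nonarch_absv R K) :=
  forall F : set_system (valued v), ProperFilter F -> cauchy F -> cvg F.

Definition locally_compact_absv (R : realType) (K : fieldType)
    (v : nonarch_absv R K) :=
  locally_compact [set: valued v].

Section residue_field.
Context {R : realType} {K : fieldType} (v : nonarch_absv R K).

Definition valuation_ring_pred : pred K := fun x => v x <= 1.

Fact valuation_ring_subring_closed : subring_closed valuation_ring_pred.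
Proof.
split=> [|x y|x y]; rewrite !unfold_in /valuation_ring_pred ?absv1// => x1 y1.
  by rewrite (le_trans (absvD _ _ _))// ge_max absvN x1.
by rewrite absvM mulr_ile1// absv_ge0.
Qed.
HB.instance Definition _ :=
  GRing.isSubringClosed.Build K valuation_ring_pred
    valuation_ring_subring_closed.

Definition valuation_ring : Type := {x : K | valuation_ring_pred x}.
HB.instance Definition _ := SubChoice.on valuation_ring.
HB.instance Definition _ :=
  [SubChoice_isSubComNzRing of valuation_ring by <:].

Definition maximal_ideal : pred valuation_ring := fun u => v (val u) < 1.

Fact maximal_ideal_closed : idealr_closed maximal_ideal.
Proof.
split=> [||u x y]; rewrite !unfold_in /maximal_ideal.
- by rewrite rmorph0 absv0 ltr01.
- by rewrite rmorph1 absv1 ltxx.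
move=> x1 y1; rewrite rmorphD rmorphM /=.
rewrite (le_lt_trans (absvD _ _ _))// gt_max y1 andbT absvM.
rewrite (le_lt_trans _ x1)// ler_piMl ?absv_ge0//; exact: (valP u).
Qed.
HB.instance Definition _ :=
  isIdealr.Build valuation_ring maximal_ideal maximal_ideal_closed.

Definition residue_field : Type :=
  {ideal_quot (maximal_ideal : idealr valuation_ring)}.
HB.instance Definition _ := GRing.ComNzRing.on residue_field.

Let residue (x : valuation_ring) : residue_field :=
  (\pi_{ideal_quot (maximal_ideal : idealr valuation_ring)} x)%qT.

Let lift (q : residue_field) : valuation_ring := repr q.

Let liftK q : residue (lift q) = q.
Proof. exact: reprK. Qed.

Let residue_eq0 x : (residue x == 0) = maximal_ideal x.
Proof. by rewrite /residue piE Quotient.equivE subr0. Qed.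

Let residue_inv (q : residue_field) : residue_field :=
  residue (insubd (0 : valuation_ring) (val (lift q))^-1).

Let residue_mulVf (q : residue_field) : q != 0 -> residue_inv q * q = 1.
Proof.
rewrite -{1 3}[q]liftK /residue_inv; set x := lift q.
rewrite residue_eq0 /maximal_ideal -leNgt => x_ge1.
have vx1 : v (val x) = 1 by apply/le_anti; rewrite x_ge1 andbT; exact: (valP x).
have x0 : val x != 0 by rewrite -(absv_eq0 v) vx1 oner_eq0.
rewrite -[LHS]rmorphM -[RHS](rmorph1 (\pi_residue_field)%qT).
congr (\pi_residue_field _)%qT; apply: val_inj.
rewrite rmorphM rmorph1 /= insubdK ?mulVf//.
by rewrite unfold_in /valuation_ring_pred absvV vx1 invr1.
Qed.

Let residue_invr0 : residue_inv 0 = 0.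
Proof.
rewrite /residue_inv; set x := lift 0.
have : maximal_ideal x by rewrite -residue_eq0 liftK.
rewrite /maximal_ideal => x_lt1; apply/eqP; rewrite residue_eq0.
rewrite /maximal_ideal val_insubd; case: ifPn => [|_]; last first.
  by rewrite rmorph0 absv0 ltr01.
rewrite /valuation_ring_pred absvV.
have [->|x0] := eqVneq (val x) 0; first by rewrite absv0 invr0.
by rewrite invf_le1 ?lt_def ?absv_eq0 ?x0 ?absv_ge0// leNgt x_lt1.
Qed.

HB.instance Definition _ := GRing.ComNzRing_isField.Build residue_field
  residue_mulVf residue_invr0.

End residue_field.

(* The sign + is encoded as true and - as false. *)
Definition bisequence (R : realType) : Type := int -> bool.

Section bisequence_metric.
Context {R : realType}.
Implicit Types s t u : bisequence R.

HB.instance Definition _ := gen_eqMixin (bisequence R).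
HB.instance Definition _ := gen_choiceMixin (bisequence R).

Definition differ_at s t (n : nat) : bool :=
  `[< exists k : int, `|k|%N = n /\ s k != t k >].

Definition bisequence_dist s t : R :=
  if pselect (exists n, differ_at s t n) is left st
  then expR (- (ex_minn st)%:R) else 0.

Let distxx s : bisequence_dist s s = 0.
Proof.
rewrite /bisequence_dist; case: pselect => // ss; exfalso.
by have [n /asboolP[k []]] := ss; rewrite eqxx.
Qed.

Let dist_positivity s t : bisequence_dist s t = 0 -> s = t.
Proof.
rewrite /bisequence_dist; case: pselect => [st /eqP|st _].
  by rewrite gt_eqF// expR_gt0.
apply/funext => k; apply/eqP; apply: contra_notT st => stk.
by exists `|k|%N; apply/asboolP; exists k.
Qed.

Let differ_sym s t : differ_at s t = differ_at t s.
Proof.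
apply/funext => n; apply: asbool_equiv_eq.
by split=> -[k [kn st]]; exists k; rewrite eq_sym.
Qed.

Let dist_sym s t : bisequence_dist s t = bisequence_dist t s.
Proof. by rewrite /bisequence_dist differ_sym. Qed.

Let dist_ge0 s t : 0 <= bisequence_dist s t.
Proof. by rewrite /bisequence_dist; case: pselect => // ?; exact: expR_ge0. Qed.

Let dist_differ s t n : differ_at s t n -> expR (- n%:R) <= bisequence_dist s t.
Proof.
move=> stn; rewrite /bisequence_dist; case: pselect => [st|[]]; last by exists n.
by case: ex_minnP => m _ /(_ _ stn); rewrite ler_expR lerN2 ler_nat.
Qed.

Let dist_triangle t s u :
  bisequence_dist s u <= bisequence_dist s t + bisequence_dist t u.
Proof.
rewrite {1}/bisequence_dist; case: pselect => [su|_]; last by rewrite addr_ge0.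
case: ex_minnP => n sun _; have /asboolP[k [kn suk]] := sun.
have [stk|stk] := eqVneq (s k) (t k).
  apply: (@le_trans _ _ (bisequence_dist t u)); last by rewrite lerDr.
  by apply: dist_differ; apply/asboolP; exists k; rewrite -stk.
apply: (@le_trans _ _ (bisequence_dist s t)); last by rewrite lerDl.
by apply: dist_differ; apply/asboolP; exists k.
Qed.

HB.instance Definition _ := isMetric.Build R (bisequence R)
  distxx dist_positivity dist_sym dist_triangle.

Lemma mdist_bisequence s t : mdist s t = bisequence_dist s t.
Proof. by []. Qed.

End bisequence_metric.

Definition bishift (R : realType) (s : bisequence R) : bisequence R :=
  fun k => s (k + 1).

Section henon.
Context {R : realType} {K : fieldType} (v : nonarch_absv R K).

Definition henon_III : set (K * K) :=
  [set ab | ab.2 != 0 /\ Num.max 1 (v ab.2 ^+ 2) < v ab.1].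

Definition henon (a b : K) (p : valued v * valued v) : valued v * valued v :=
  (a + b * p.2 - p.1 ^+ 2, p.1).

Definition henon_inv (a b : K) (p : valued v * valued v) :
    valued v * valued v :=
  (p.2, b^-1 * (- a + p.1 + p.2 ^+ 2)).

Lemma henonK a b : b != 0 -> cancel (henon a b) (henon_inv a b).
Proof.
by move=> b0 [x y]; rewrite /henon /henon_inv /=; congr pair; field.
Qed.

Lemma henon_invK a b : b != 0 -> cancel (henon_inv a b) (henon a b).
Proof.
by move=> b0 [x y]; rewrite /henon /henon_inv /=; congr pair; field.
Qed.

Definition henon_iter (a b : K) (n : int) :
    valued v * valued v -> valued v * valued v :=
  match n with
  | Posz m => iter m (henon a b)
  | Negz m => iter m.+1 (henon_inv a b)
  end.

Definition filled_julia_set (a b : K) : set (valued v * valued v) :=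
  [set p | exists M : R, forall n : int,
     Num.max (v (henon_iter a b n p).1) (v (henon_iter a b n p).2) <= M].

End henon.

Arguments henon {R K} v a b p.
Arguments henon_inv {R K} v a b p.
Arguments henon_iter {R K} v a b n p.
Arguments filled_julia_set {R K} v a b.

Definition homeomorphism (T U : topologicalType) (f : T -> U) :=
  continuous f /\ exists g : U -> T, [/\ continuous g, cancel f g & cancel g f].

(* Main.v *)
(* Write a = c^2, r = |c| and beta = max(1, |b|), so that beta < r; odd residue
   characteristic gives |2| = 1. Points of J(phi) correspond to bounded
   solutions of z_(k+1) = a + b z_(k-1) - z_k^2. For such a solution |z_k| <= r,
   hence |z_k - c| |z_k + c| = |b z_(k-1) - z_(k+1)| <= beta r, and since
   |2c| = r exactly one of the two factors is at most beta: this defines the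
   sign s_k. Two solutions with the same sign at k satisfy |z_k + w_k| = r, so
   |z_k - w_k| <= (beta/r) max(|z_(k-1) - w_(k-1)|, |z_(k+1) - w_(k+1)|);
   iterating this gives uniqueness and continuity of s |-> z. Existence is the
   contraction principle for the equation rewritten with d_k = c or -c as
   z_k - d_k = (b z_(k-1) - z_(k+1) - (z_k - d_k)^2) / (2 d_k). Conversely
   nearby points have nearby orbits over a bounded time window, hence equal
   signs there. *)
Require Import Defs.
From HB Require Import structures.
From mathcomp Require Import all_boot all_order all_algebra.
From mathcomp Require Import all_classical all_reals all_analysis.
From mathcomp Require Import ring zify.

Set Implicit Arguments.
Unset Strict Implicit.
Unset Printing Implicit Defensive.

Import Order.TTheory GRing.Theory Num.Theory.

Local Open Scope classical_set_scope.
Local Open Scope ring_scope.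

(** * Geometric decay *)

Lemma geometric_lt (R : realType) (l M e : R) : 0 <= l < 1 -> 0 < e ->
  exists n, M * l ^+ n < e.
Proof.
move=> /andP[l0 l1] e0.
have M0 : 0 < `|M| + 1 by rewrite ltr_wpDl.
have /cvgrPdist_lt/(_ (e / (`|M| + 1))) : (GRing.exp l : R^nat) @ \oo --> 0.
  by apply: cvg_expr; rewrite ger0_norm.
rewrite divr_gt0// => /(_ isT)[n _ /(_ n (leqnn n))] /=.
rewrite sub0r normrN ger0_norm ?exprn_ge0// ltr_pdivlMr// mulrC => h.
exists n; apply: le_lt_trans h; rewrite ler_wpM2r ?exprn_ge0//.
by rewrite (le_trans (ler_norm _))// lerDl.
Qed.

Lemma le_geometric_le0 (R : realType) (l M x : R) : 0 <= l < 1 ->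
  (forall n, x <= M * l ^+ n) -> x <= 0.
Proof.
move=> l01 xM; rewrite leNgt; apply/negP => x0.
by have [n] := geometric_lt M l01 x0; rewrite ltNge xM.
Qed.

(** * Ultrametric estimates, the absolute value of 2, and completeness *)

Section ultrametric.
Context {R : realType} {K : fieldType} (v : nonarch_absv R K).
Implicit Types (x y : K) (e : R).

Lemma absvX x n : v (x ^+ n) = v x ^+ n.
Proof. by elim: n => [|n IH]; rewrite ?absv1// !exprS absvM IH. Qed.

Lemma absvD_le x y e : v x <= e -> v y <= e -> v (x + y) <= e.
Proof. by move=> xe ye; rewrite (le_trans (absvD v _ _))// ge_max xe. Qed.

Lemma absvB_le x y e : v x <= e -> v y <= e -> v (x - y) <= e.
Proof. by move=> xe ye; rewrite absvD_le// absvN. Qed.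

Lemma absvD_lt x y e : v x < e -> v y < e -> v (x + y) < e.
Proof. by move=> xe ye; rewrite (le_lt_trans (absvD v _ _))// gt_max xe. Qed.

Lemma absvB_lt x y e : v x < e -> v y < e -> v (x - y) < e.
Proof. by move=> xe ye; rewrite absvD_lt// absvN. Qed.

Lemma absvB_sym x y : v (x - y) = v (y - x).
Proof. by rewrite -opprB absvN. Qed.

Lemma absv_near x y : v (x - y) < v y -> v x = v y.
Proof.
move=> xy; apply/le_anti/andP; split.
  by rewrite -(subrK y x) absvD_le// ltW.
rewrite leNgt; apply/negP => xlty.
by have := absvB_lt xlty xy; rewrite subKr ltxx.
Qed.

Lemma absv_nat_le1 n : v n%:R <= 1.
Proof.
elim: n => [|n IH]; first by rewrite absv0.
by rewrite -natr1 absvD_le// absv1.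
Qed.

(** The prime [p] vanishes in the residue field, so [v p%:R < 1]. As 1 is [p] minus twice [p./2],
    having [v 2 < 1] would force [v 1 < 1]. *)
Lemma absv2_eq1 : (exists2 p, p \in [pchar (residue_field v)] & odd p) ->
  v 2 = 1.
Proof.
move=> [p /andP[_ /eqP p0] odd_p].
have vp : v p%:R < 1.
  have : maximal_ideal (p%:R : valuation_ring v).
    rewrite -[maximal_ideal _]/(p%:R \in (maximal_ideal (v := v) : idealr _)).
    rewrite -[p%:R]subr0 -Quotient.equivE -(eqquotE (residue_field v)).
    pose f : {rmorphism valuation_ring v -> residue_field v} :=
      (\pi_(residue_field v))%qT.
    by apply/eqP; rewrite -[LHS]/(f _) -[RHS]/(f _) rmorph_nat rmorph0 p0.
  by rewrite /maximal_ideal rmorph_nat.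
apply/le_anti; rewrite absv_nat_le1/= leNgt; apply/negP => v2.
have : v 1 < 1; last by rewrite absv1 ltxx.
have -> : 1 = p%:R - 2 * (p./2)%:R :> K.
  by rewrite -natrM -{1}(odd_double_half p) odd_p -mul2n natrD addrK.
rewrite absvB_lt// absvM (le_lt_trans _ v2)// ler_piMr ?absv_ge0//.
exact: absv_nat_le1.
Qed.

Context (v_complete : complete_absv v).

(** An ultrametric telescoping sum is no larger than its largest term, so the bound on steps passes
    to the limit with the same constant [C]. *)
Lemma cvg_geometric_absv (u : nat -> K) (C l : R) : 0 <= l < 1 ->
  (forall n, v (u n.+1 - u n) <= C * l ^+ n) ->
  exists x, forall n, v (x - u n) <= C * l ^+ n.
Proof.
move=> l01 ul; have /andP[l0 /ltW l1] := l01.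
have C0 : 0 <= C.
  by have := ul 0; rewrite expr0 mulr1; apply: le_trans; exact: absv_ge0.
have um n m : v (u (n + m)%N - u n) <= C * l ^+ n.
  elim: m => [|m IH]; first by rewrite addn0 subrr absv0 mulr_ge0// exprn_ge0.
  rewrite addnS -(subrKA (u (n + m)%N)) absvD_le// (le_trans (ul _))//.
  by rewrite ler_wpM2l// exprD ler_piMr ?exprn_ge0// exprn_ile1.
pose F : set_system (valued v) := (u : nat -> valued v) @ \oo.
have /v_complete/cvg_ex[x Fx] : cauchy F.
  apply: cauchy_exP => e e0.
  have [n ne] := geometric_lt C l01 e0.
  exists (u n); exists n => // m /= nm; rewrite ballEmdist /= mdist_valued.
  by rewrite absvB_sym -(subnKC nm) (le_lt_trans (um _ _)).
(* Otherwise some late term is closer to [x] than [u n] is, and the ultrametric inequality makes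
   [v (x - u n)] smaller than itself. *)
exists x => n; rewrite leNgt; apply/negP => lt_un.
have e0 : 0 < v ((x : K) - u n).
  by apply: le_lt_trans lt_un; rewrite mulr_ge0// exprn_ge0.
have [m _ /(_ (n + m)%N (leq_addl _ _))] :=
  (cvg_ballP (u : nat -> valued v) x).1 Fx _ e0.
rewrite /= ballEmdist /= mdist_valued => xu.
have := absvD_lt xu (le_lt_trans (um n m) lt_un).
by rewrite subrKA ltxx.
Qed.
End ultrametric.

(** * Bounded solutions of the recurrence: localisation, uniqueness and existence *)

Definition henon_orbit (K : fieldType) (a b : K) (z : int -> K) :=
  forall k, z (k + 1) = a + b * z (k - 1) - z k ^+ 2.

Definition signed (K : fieldType) (c : K) (e : bool) : K :=
  if e then c else - c.

Section henon_orbits.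
Context {R : realType} {K : fieldType} (v : nonarch_absv R K) (b c : K).

Let beta : R := Num.max 1 (v b).
Let lam : R := beta / v c.

Context (v2 : v 2 = 1) (beta_lt : beta < v c).

Let beta_gt0 : 0 < beta.
Proof. by rewrite /beta lt_max ltr01. Qed.

Let c_gt0 : 0 < v c. Proof. exact: lt_trans beta_lt. Qed.

Let lam01 : 0 <= lam < 1.
Proof. by rewrite /lam divr_ge0 ?ltW//= ltr_pdivrMr// mul1r. Qed.

Let betaE : beta = lam * v c.
Proof. by rewrite /lam divfK// gt_eqF. Qed.

Let lam_ge0 : 0 <= lam. Proof. by case/andP: lam01. Qed.

Lemma sqr_signed e : signed c e ^+ 2 = c ^+ 2.
Proof. by case: e; rewrite /= ?sqrrN. Qed.

Lemma absv_signed e : v (signed c e) = v c.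
Proof. by case: e; rewrite /= ?absvN. Qed.

Lemma absv_signed2 e : v (2 * signed c e) = v c.
Proof. by rewrite absvM v2 mul1r absv_signed. Qed.

(** The two centres differ by [2 * c] up to sign, which has size [v c], so the open balls of radius
    [v c] around them are disjoint. *)
Lemma signed_inj x e e' :
  v (x - signed c e) < v c -> v (x - signed c e') < v c -> e = e'.
Proof.
move=> xe xe'; apply/eqP/negP => ee'.
have : v (2 * signed c e') < v c; last by rewrite absv_signed2 ltxx.
have -> : 2 * signed c e' = (x - signed c e) - (x - signed c e').
  by move: e e' ee' {xe xe'} => [] []//= _; ring.
exact: absvB_lt.
Qed.

Lemma absv_henon_le x y m : v x <= m -> v y <= m ->
  v (b * x - y) <= beta * m.
Proof.
move=> xm ym; have m0 : 0 <= m by apply: le_trans xm; exact: absv_ge0.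
rewrite absvB_le//.
  by rewrite absvM ler_pM ?absv_ge0// /beta le_max lexx orbT.
by rewrite (le_trans ym)// ler_peMl// /beta le_max lexx.
Qed.

Lemma absv_sqr_near x e : v (x ^+ 2 - c ^+ 2) <= beta * v c ->
  v x <= v c -> v (x - signed c e) = v c -> v (x - signed c (~~ e)) <= beta.
Proof.
move=> x2 xc xe; rewrite -(ler_pM2r c_gt0) -{1}xe -absvM.
suff -> : (x - signed c (~~ e)) * (x - signed c e) = x ^+ 2 - c ^+ 2 by [].
by case: e {xe}; rewrite /=; ring.
Qed.

(** A bootstrap: where [v (z k)] exceeds [v c], the recurrence bounds its square by [beta] times the
    current bound, and dividing by [v c] improves that bound by the factor [lam]. *)
Lemma bounded_orbit_le z M : henon_orbit (c ^+ 2) b z ->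
  (forall k, v (z k) <= M) -> forall k, v (z k) <= v c.
Proof.
move=> zP zM.
have zn n k : v (z k) <= Num.max (v c) (M * lam ^+ n).
  elim: n k => [|n IH] k; first by rewrite expr0 mulr1 le_max zM orbT.
  rewrite le_max; have [//|zc] := leP (v (z k)) (v c); rewrite orFb.
  have : v (z k ^+ 2) <=
      Num.max (v c ^+ 2) (beta * Num.max (v c) (M * lam ^+ n)).
    have -> : z k ^+ 2 = c ^+ 2 + (b * z (k - 1) - z (k + 1)).
      by rewrite (zP k); ring.
    rewrite (le_trans (absvD v _ _))// absvX ge_max le_max lexx/=.
    by rewrite le_max absv_henon_le ?orbT.
  rewrite absvX (maxr_pMr _ _ (ltW beta_gt0)) !le_max.
  (* The alternatives [v c ^+ 2] and [beta * v c] are both too small to bound [v (z k) ^+ 2]; only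
     the one with [M] survives. *)
  have sqr_gt y : y <= v c * v c -> (v (z k) ^+ 2 <= y) = false.
    move=> yc; apply/negbTE; rewrite -ltNge (le_lt_trans yc)// -expr2.
    by rewrite ltr_pXn2r ?nnegrE ?absv_ge0.
  have cc : v c ^+ 2 <= v c * v c by rewrite expr2.
  have bc : beta * v c <= v c * v c by rewrite ler_pM2r// ltW.
  rewrite (sqr_gt _ cc) (sqr_gt _ bc) /=.
  move=> zk2; rewrite -(ler_pM2r c_gt0).
  have -> : M * lam ^+ n.+1 * v c = beta * (M * lam ^+ n).
    by rewrite betaE exprS; ring.
  by apply: le_trans zk2; rewrite expr2 ler_wpM2l ?absv_ge0// ltW.
move=> k; rewrite leNgt; apply/negP => ck.
have [n] := geometric_lt M lam01 c_gt0; apply/negP; rewrite -leNgt.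
have := zn n k; rewrite le_max leNgt ck/= => /(lt_le_trans ck).
exact: ltW.
Qed.

(** The factors [z k - c] and [z k + c] have a product of size at most [beta * v c] and cannot both
    be smaller than [v c]: one has size exactly [v c], hence the other at most [beta]. *)
Lemma bounded_orbit_near z M : henon_orbit (c ^+ 2) b z ->
  (forall k, v (z k) <= M) ->
  forall k, v (z k - signed c (v (z k - c) < v c)) <= beta.
Proof.
move=> zP /(bounded_orbit_le zP) zc k.
have z2 : v (z k ^+ 2 - c ^+ 2) <= beta * v c.
  have -> : z k ^+ 2 - c ^+ 2 = b * z (k - 1) - z (k + 1).
    by rewrite (zP k); ring.
  exact: absv_henon_le.
have lec e : v (z k - signed c e) <= v c by rewrite absvB_le ?absv_signed.
have [zkc|zkc] := ltP; last first.
  apply: (@absv_sqr_near _ true) => //; apply/le_anti.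
  by rewrite (lec true) zkc.
apply: (@absv_sqr_near _ false) => //; apply/le_anti; rewrite lec/= leNgt.
by apply/negP => /(signed_inj (e := true) (e' := false) zkc).
Qed.

Lemma near_signed_le x e : v (x - signed c e) <= beta -> v x <= v c.
Proof.
move=> xe; rewrite -(subrK (signed c e) x) absvD_le ?absv_signed//.
by rewrite (le_trans xe)// ltW.
Qed.

(* The index window shrinks by one on each side at every use of the recurrence,
   so agreement of signs up to distance [n] yields [n] contraction factors. *)
Lemma orbit_close z w s k n :
  henon_orbit (c ^+ 2) b z -> henon_orbit (c ^+ 2) b w ->
  (forall j, v (z j) <= v c) -> (forall j, v (w j) <= v c) ->
  (forall j : int, (`|j - k| <= n)%N ->
    v (z j - signed c (s j)) <= beta /\ v (w j - signed c (s j)) <= beta) ->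
  v (z k - w k) <= v c * lam ^+ n.
Proof.
move=> zP wP zc wc; elim: n k => [|n IH] k s_near.
  by rewrite expr0 mulr1 absvB_le.
have nbr (j : int) : (`|j - k| <= 1)%N -> v (z j - w j) <= v c * lam ^+ n.
  by move=> jk; apply: IH => i ij; apply: s_near; lia.
(* Both terms lie near the same centre, so their sum has the size of twice that centre. Dividing the
   difference of squares by it produces the contraction. *)
have zw : v (z k + w k) = v c.
  rewrite -(absv_signed2 (s k)); apply: absv_near; rewrite absv_signed2.
  have [zk wk] := s_near k ltac:(lia).
  have -> : z k + w k - 2 * signed c (s k) =
    (z k - signed c (s k)) + (w k - signed c (s k)) by ring.
  by rewrite absvD_lt// (le_lt_trans _ beta_lt).
rewrite -(ler_pM2r c_gt0) -[X in _ * X <= _]zw -absvM.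
have -> : (z k - w k) * (z k + w k) =
    b * (z (k - 1) - w (k - 1)) - (z (k + 1) - w (k + 1)).
  by rewrite (zP k) (wP k); ring.
rewrite (@le_trans _ _ (beta * (v c * lam ^+ n)))//.
  by apply: absv_henon_le; apply: nbr; lia.
by rewrite betaE exprS le_eqVlt; apply/orP; left; apply/eqP; ring.
Qed.

Lemma eq_orbit z w s :
  henon_orbit (c ^+ 2) b z -> henon_orbit (c ^+ 2) b w ->
  (forall k, v (z k - signed c (s k)) <= beta) ->
  (forall k, v (w k - signed c (s k)) <= beta) -> z =1 w.
Proof.
move=> zP wP zs ws k; apply/eqP; rewrite -subr_eq0 -(absv_eq0 v).
rewrite eq_le absv_ge0 andbT; apply: (le_geometric_le0 lam01) => n.
by apply: (@orbit_close _ _ s) => // j; exact: near_signed_le.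
Qed.

(* The fixed points of [newton s] are the solutions of the recurrence: Newton's
   square-root step at [signed c (s k)], with the quadratic term kept. *)
Let newton (s : int -> bool) (z : int -> K) (k : int) : K :=
  let d := signed c (s k) in
  d + (b * z (k - 1) - z (k + 1) - (z k - d) ^+ 2) / (2 * d).

Let newton_near s z : (forall k, v (z k - signed c (s k)) <= beta) ->
  forall k, v (newton s z k - signed c (s k)) <= beta.
Proof.
move=> zs k; rewrite /newton; set d := signed c (s k).
rewrite addrC addKr absvM absvV absv_signed2 ler_pdivrMr//.
rewrite absvB_le// ?absv_henon_le//; try exact: near_signed_le.
by rewrite absvX expr2 ler_pM ?absv_ge0// (le_trans (zs k))// ltW.
Qed.

Let newton_contract s z w m :
  (forall k, v (z k - signed c (s k)) <= beta) ->
  (forall k, v (w k - signed c (s k)) <= beta) ->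
  (forall k, v (z k - w k) <= m) ->
  forall k, v (newton s z k - newton s w k) <= lam * m.
Proof.
move=> zs ws zw k; rewrite /newton; set d := signed c (s k).
rewrite opprD addrACA subrr add0r -mulrBl absvM absvV absv_signed2.
rewrite mulrAC ler_pM2r ?invr_gt0//.
(* The quadratic terms differ by [z k - w k] times a sum of two errors of size at most [beta], so
   they contract at the same rate as the linear ones. *)
have -> : b * z (k - 1) - z (k + 1) - (z k - d) ^+ 2 -
    (b * w (k - 1) - w (k + 1) - (w k - d) ^+ 2) =
  (b * (z (k - 1) - w (k - 1)) - (z (k + 1) - w (k + 1))) -
  ((z k - d) + (w k - d)) * (z k - w k) by ring.
rewrite absvB_le ?absv_henon_le// absvM ler_pM ?absv_ge0//.
by rewrite absvD_le// ?zs ?ws.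
Qed.

(** [newton s] is iterated from the sequence of centres. The geometric rate of convergence is
    uniform in [k], which makes the coordinatewise limit a fixed point. *)
Lemma orbit_exists s : complete_absv v ->
  exists2 z, henon_orbit (c ^+ 2) b z &
             forall k, v (z k - signed c (s k)) <= beta.
Proof.
move=> v_complete.
pose u n := iter n (newton s) (fun k => signed c (s k)).
have us n k : v (u n k - signed c (s k)) <= beta.
  elim: n k => [|n IH] k; first by rewrite subrr absv0 ltW.
  exact: newton_near.
have uS n k : v (u n.+1 k - u n k) <= beta * lam ^+ n.
  elim: n k => [|n IH] k; first by rewrite expr0 mulr1; exact: us 1%N k.
  by rewrite exprS mulrCA; exact: (newton_contract (us n.+1) (us n) IH).
have /choice[z zu] k : exists x, forall n, v (x - u n k) <= beta * lam ^+ n.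
  by apply: (@cvg_geometric_absv _ _ v v_complete _ _ _ lam01) => n; exact: uS.
have zs k : v (z k - signed c (s k)) <= beta.
  by have := zu k 0; rewrite expr0 mulr1.
exists z => // k.
have newtonK : newton s z k = z k.
  apply/eqP; rewrite -subr_eq0 -(absv_eq0 v) eq_le absv_ge0 andbT.
  apply: (le_geometric_le0 (M := beta) lam01) => n.
  have lamS : beta * lam ^+ n.+1 <= beta * lam ^+ n.
    rewrite exprS mulrCA ler_piMl ?mulr_ge0 ?exprn_ge0 ?(ltW beta_gt0)//.
    by case/andP: lam01 => _ /ltW.
  rewrite -(subrKA (u n.+1 k)) absvD_le//; last first.
    by rewrite absvB_sym (le_trans (zu k n.+1)).
  rewrite (le_trans (newton_contract zs (us n) (fun j => zu j n) k))//.
  by rewrite mulrCA -exprS.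
(* Clearing the denominator [2 * d] in the fixed point equation and using [d ^+ 2 = c ^+ 2] recovers
   the recurrence. *)
move: newtonK; rewrite /newton; set d := signed c (s k) => newtonK.
have d2 : 2 * d != 0 by rewrite -(absv_eq0 v) absv_signed2 gt_eqF.
have zd : b * z (k - 1) - z (k + 1) - (z k - d) ^+ 2 = (z k - d) * (2 * d).
  by rewrite -[X in _ = (X - d) * _]newtonK [d + _]addrC addrK divfK.
have -> : z (k + 1) = b * z (k - 1) - (z k - d) ^+ 2 -
    (b * z (k - 1) - z (k + 1) - (z k - d) ^+ 2) by ring.
by rewrite zd -(sqr_signed (s k)) -/d; ring.
Qed.

End henon_orbits.

(** * Points of the plane as two-sided solutions of the recurrence *)

Section orbit_of_point.
Context {R : realType} {K : fieldType} (v : nonarch_absv R K) (a b : K).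
Context (b0 : b != 0).
Implicit Types p : valued v * valued v.

Definition orbit_of (p : valued v * valued v) (k : int) : K :=
  (henon_iter v a b k p).1.

Lemma henon_iterS k p :
  henon_iter v a b (k + 1) p = henon v a b (henon_iter v a b k p).
Proof.
case: k => [m|[|m]].
- by have -> : Posz m + 1 = m.+1 by lia.
- by rewrite [RHS]henon_invK.
- have -> : Negz m.+1 + 1 = Negz m by lia.
  by rewrite /= henon_invK.
Qed.

Lemma henon_iterB1 k p :
  henon_iter v a b (k - 1) p = henon_inv v a b (henon_iter v a b k p).
Proof. by rewrite -[in RHS](subrK 1 k) henon_iterS henonK. Qed.

(** The second coordinate of [henon] is the previous first coordinate, so one scalar sequence
    encodes the whole orbit. *)
Lemma henon_iter_orbit p k :
  henon_iter v a b k p = (orbit_of p k, orbit_of p (k - 1)).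
Proof.
by rewrite /orbit_of henon_iterB1 /henon_inv /=; case: henon_iter.
Qed.

Lemma orbit_of_henon_orbit p : henon_orbit a b (orbit_of p).
Proof.
by move=> k; rewrite {1}/orbit_of henon_iterS henon_iter_orbit.
Qed.

Lemma point_of_orbit p : p = (orbit_of p 0, orbit_of p (-1)).
Proof. exact: (henon_iter_orbit p 0). Qed.

Lemma orbit_of_orbit (z : int -> K) : henon_orbit a b z ->
  orbit_of (z 0, z (-1)) =1 z.
Proof.
move=> zP k; rewrite /orbit_of.
suff -> : henon_iter v a b k (z 0, z (-1)) = (z k, z (k - 1)) by [].
elim/int_rect: k => [|n IH|n IH]; first by rewrite sub0r.
  rewrite -addn1 PoszD henon_iterS IH /henon /= addrK.
  by rewrite (zP n).
have -> : - Posz n.+1 = - Posz n - 1 by lia.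
rewrite henon_iterB1 IH /henon_inv /=; congr pair.
have := zP (- Posz n - 1); rewrite subrK => ->.
by field.
Qed.

Lemma henon_orbit_shift (z : int -> K) :
  henon_orbit a b z -> henon_orbit a b (fun k => z (k + 1)).
Proof. by move=> zP k; rewrite zP addrK subrK. Qed.

Lemma orbit_of_henon p k : orbit_of (henon v a b p) k = orbit_of p (k + 1).
Proof.
rewrite -(orbit_of_orbit (henon_orbit_shift (orbit_of_henon_orbit p))).
by congr orbit_of; rewrite addNr.
Qed.

Lemma filled_julia_setP p :
  filled_julia_set v a b p <-> exists M, forall k, v (orbit_of p k) <= M.
Proof.
split=> -[M pM]; exists M => k.
  by have := pM k; rewrite ge_max => /andP[].
by rewrite henon_iter_orbit ge_max !pM.
Qed.

End orbit_of_point.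

(** * Balls of bisequences as agreement on finite windows *)

Section bisequence_dist.
Context {R : realType}.
Implicit Types s t : bisequence R.

Lemma bisequence_dist_lt s t n : bisequence_dist s t < expR (- n%:R) ->
  forall k, (`|k| <= n)%N -> s k = t k.
Proof.
move=> st k kn; apply/eqP/negPn/negP => stk.
have dk : differ_at s t `|k|%N by apply/asboolP; exists k.
move: st; rewrite /bisequence_dist; case: pselect => [ex|[]]; last first.
  by exists `|k|%N.
case: ex_minnP => m _ /(_ _ dk) mk; rewrite ltr_expR ltrN2 ltr_nat.
by rewrite ltnNge (leq_trans mk).
Qed.

Lemma bisequence_dist_le s t n : (forall k, (`|k| <= n)%N -> s k = t k) ->
  bisequence_dist s t <= expR (- n%:R).
Proof.
move=> st; rewrite /bisequence_dist; case: pselect => [ex|_]; last first.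
  exact: expR_ge0.
case: ex_minnP => m /asboolP[k [km stk]] _.
rewrite ler_expR lerN2 ler_nat leqNgt; apply/negP => mn.
by rewrite st ?eqxx// km ltnW in stk.
Qed.

End bisequence_dist.

(** Differences grow at most geometrically when the recurrence is solved for its newest term on the
    right and, after division by [b], for its oldest term on the left. The base
    [r * Num.max 1 (v b)^-1] dominates the loss in both directions; the window is asymmetric because
    the data sit at [0] and [-1]. *)
Lemma orbit_expand (R : realType) (K : fieldType) (v : nonarch_absv R K)
    (a b : K) (r m : R) (z w : int -> K) (n : nat) (k : int) :
  b != 0 -> 1 <= r -> v b <= r ->
  henon_orbit a b z -> henon_orbit a b w ->
  (forall j, v (z j) <= r) -> (forall j, v (w j) <= r) ->
  v (z 0 - w 0) <= m -> v (z (-1) - w (-1)) <= m ->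
  - Posz n.+1 <= k <= Posz n ->
  v (z k - w k) <= (r * Num.max 1 (v b)^-1) ^+ n * m.
Proof.
move=> b0 r1 br zP wP zr wr zw0 zw1; set C := r * _.
have r0 : 0 <= r by apply: le_trans r1.
have m0 : 0 <= m by apply: le_trans zw0; exact: absv_ge0.
have rC : r <= C by rewrite ler_peMr// le_max lexx.
have bC : (v b)^-1 * r <= C by rewrite mulrC ler_wpM2l// le_max lexx orbT.
have C0 : 0 <= C by apply: le_trans rC.
elim: n k => [|n IH] k kn.
  rewrite expr0 mul1r; have /orP[/eqP->//|/eqP->//] : (k == 0) || (k == -1).
  by lia.
set q := C ^+ n * m in IH; have q0 : 0 <= q by rewrite mulr_ge0// exprn_ge0.
have -> : C ^+ n.+1 * m = C * q by rewrite exprS mulrA.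
have zw j : v (z j + w j) <= r by rewrite absvD_le.
have Mr x y : v x <= q -> v y <= r -> v (x * y) <= r * q.
  by move=> xq yr; rewrite absvM mulrC ler_pM ?absv_ge0.
(* Only the two ends [n.+1] and [- n.+2] of the enlarged window are new; they use the forward and
   the backward step respectively. *)
have [k1|k1] := leP k n; last first.
  have -> : z k - w k = b * (z (k - 2) - w (k - 2))
      - (z (k - 1) - w (k - 1)) * (z (k - 1) + w (k - 1)).
    have := zP (k - 1); have := wP (k - 1).
    have -> : k - 1 + 1 = k by lia.
    have -> : k - 1 - 1 = k - 2 by lia.
    move=> -> ->.
    ring.
  apply: (@le_trans _ _ (r * q)); last exact: ler_wpM2r.
  apply: absvB_le; last by apply: Mr => //; apply: IH; lia.
  by rewrite mulrC; apply: Mr => //; apply: IH; lia.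
have [k2|k2] := leP (- Posz n.+1) k.
  by rewrite (le_trans (IH _ _)) ?k2// ler_peMl// (le_trans r1).
have -> : z k - w k = b^-1 * ((z (k + 2) - w (k + 2))
      + (z (k + 1) - w (k + 1)) * (z (k + 1) + w (k + 1))).
  have := zP (k + 1); have := wP (k + 1); rewrite !addrK.
  have -> : k + 1 + 1 = k + 2 by lia.
  move=> -> ->.
  by field.
apply: (@le_trans _ _ ((v b)^-1 * r * q)); last exact: ler_wpM2r.
rewrite -mulrA absvM absvV ler_wpM2l ?invr_ge0 ?absv_ge0//.
apply: absvD_le; last by apply: Mr => //; apply: IH; lia.
by apply: (@le_trans _ _ q); [apply: IH; lia | exact: ler_peMl].
Qed.

(** * The coding map: bijectivity, equivariance and continuity in both directions *)

Lemma continuous_ball (R : numDomainType) (T : topologicalType)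
    (M : pseudoMetricType R) (f : T -> M) :
  (forall x (e : R), 0 < e -> \forall y \near x, ball (f x) e (f y)) ->
  continuous f.
Proof. by move=> fP x; apply/cvg_ballP => e; exact: fP. Qed.

Theorem theorem5p7 (R : realType) (K : fieldType) (v : nonarch_absv R K)
    (v_nontrivial : nontrivial_absv v)
    (v_complete : complete_absv v)
    (v_locally_compact : locally_compact_absv v)
    (residue_char_odd : exists2 p, p \in [pchar (residue_field v)] & odd p)
    (a b : K) (ab_III : henon_III v (a, b))
    (a_square : exists c : K, a = c ^+ 2) :
  exists omega : bisequence R -> filled_julia_set v a b,
    homeomorphism omega /\
    forall s, \val (omega (bishift s)) = henon v a b (\val (omega s)).
Proof.
have v2 := absv2_eq1 residue_char_odd.
case: a_square => c ac; rewrite {}ac in ab_III *.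
have [b0 cb] : b != 0 /\ Num.max 1 (v b ^+ 2) < v (c ^+ 2) := ab_III.
set beta := Num.max 1 (v b).
have beta_lt : beta < v c.
  have sqr_lt x : 0 <= x -> x ^+ 2 < v c ^+ 2 -> x < v c.
    by move=> x0; rewrite ltr_pXn2r ?nnegrE ?absv_ge0.
  move: cb; rewrite absvX !gt_max => /andP[c1 bc].
  by rewrite !sqr_lt ?absv_ge0 ?expr1n.
have [c1 bc] : 1 < v c /\ v b < v c by move: beta_lt; rewrite gt_max => /andP[].
have beta_ge0 : 0 <= beta by rewrite le_max ler01.
have lam01 : 0 <= beta / v c < 1.
  have c0 : 0 < v c by exact: lt_trans c1.
  by rewrite divr_ge0 ?(ltW c0)//= ltr_pdivrMr// mul1r.
pose J := filled_julia_set v (c ^+ 2) b.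
pose z (p : J) := orbit_of (c ^+ 2) b (\val p).
have zP p : henon_orbit (c ^+ 2) b (z p) by exact: orbit_of_henon_orbit.
have z_bd p : exists M, forall k, v (z p k) <= M.
  by apply/(filled_julia_setP _ b0); exact: set_valP.
have zc p k : v (z p k) <= v c.
  by have [M zM] := z_bd p; exact: (bounded_orbit_le beta_lt (zP p) zM).
(* The candidate inverse: the sign is + exactly when the orbit term lies in the open ball of radius
   [v c] around [c]. *)
pose itin (p : J) : bisequence R := fun k => v (z p k - c) < v c.
have itinP p k : v (z p k - signed c (itin p k)) <= beta.
  by have [M zM] := z_bd p; exact: (bounded_orbit_near v2 beta_lt (zP p) zM).
have z_inj p q : z p =1 z q -> p = q.
  move=> pq; apply: val_inj.
  rewrite (point_of_orbit (v := v) (c ^+ 2) b0 (\val p)).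
  rewrite (point_of_orbit (v := v) (c ^+ 2) b0 (\val q)).
  by congr pair; [exact: (pq 0) | exact: (pq (-1))].
have /choice[omega omegaP] (s : bisequence R) : exists p : J,
    forall k, v (z p k - signed c (s k)) <= beta.
  have [u uP us] := orbit_exists v2 beta_lt s v_complete.
  have uJ : J (u 0, u (-1)).
    apply/(filled_julia_setP _ b0); exists (v c) => k.
    by rewrite orbit_of_orbit//; exact: (near_signed_le beta_lt (us k)).
  by exists (SigSub (mem_set uJ)) => k; rewrite /z /= orbit_of_orbit.
have itinK : cancel omega itin.
  move=> s; apply/funext => k.
  have lt_c e : v (z (omega s) k - signed c e) <= beta ->
      v (z (omega s) k - signed c e) < v c.
    by move=> h; exact: le_lt_trans beta_lt.
  exact: (signed_inj v2 (lt_c _ (itinP _ _)) (lt_c _ (omegaP _ _))).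
have omegaK : cancel itin omega.
  move=> p; apply: z_inj.
  exact: (eq_orbit v2 beta_lt (zP _) (zP _) (omegaP _) (itinP p)).
exists omega; split; last first.
  move=> s; set p := omega s.
  rewrite (point_of_orbit (v := v) (c ^+ 2) b0 (\val (omega (bishift s)))).
  rewrite (point_of_orbit (v := v) (c ^+ 2) b0 (henon _ _ _ _)).
  suff E k : z (omega (bishift s)) k = orbit_of (c ^+ 2) b
    (henon v (c ^+ 2) b (\val p)) k by rewrite -!E.
  rewrite orbit_of_henon//.
  (* The orbit of [p] moved by one index follows the shifted signs, so uniqueness identifies it with
     the orbit of [omega (bishift s)]. *)
  have shiftP := henon_orbit_shift (zP p).
  apply: (eq_orbit v2 beta_lt (zP _) shiftP (omegaP _) _ k) => j.
  exact: omegaP.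
split.
  apply: continuous_comp_initial; apply: continuous_ball => s e e0.
  have [n ne] := geometric_lt (v c) lam01 e0.
  (* The coordinates are the terms at [0] and [-1], and the window of radius [n] around [-1] reaches
     [- n.+1]; hence signs must agree up to [n.+1]. *)
  apply/nbhs_ballP; exists (expR (- n.+1%:R)); first exact: expR_gt0.
  move=> t; rewrite ballEmdist /= mdist_bisequence => /bisequence_dist_lt st.
  have close k : (`|k| <= 1)%N -> v (z (omega s) k - z (omega t) k) < e.
    move=> k1; apply: le_lt_trans ne.
    apply: (orbit_close (s := s) v2 beta_lt) => // j jk.
    by split; [exact: omegaP | rewrite st ?omegaP//; lia].
  split; rewrite ballEmdist /= mdist_valued;
    [exact: (close 0) | exact: (close (-1))].
exists itin; split => //; apply: continuous_ball => p e e0.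
have expN1 : 0 <= expR (-1 : R) < 1 by rewrite expR_ge0 expR_lt1 ltrN10.
have [N] := geometric_lt 1 expN1 e0; rewrite mul1r -expRM_natr mulN1r => Ne.
pose C := v c * Num.max 1 (v b)^-1.
have C0 : 0 < C by rewrite mulr_gt0 ?(lt_trans _ c1)// lt_max ltr01.
have beta_gt0 : 0 < beta by rewrite lt_max ltr01.
(* With this radius, [N] expansions by [C] reach only [beta], which is still below [v c]. *)
have d0 : 0 < beta / C ^+ N by rewrite divr_gt0 ?exprn_gt0.
have pB : \forall q \near p,
    ball (\val p : valued v * valued v) (beta / C ^+ N) (\val q).
  exact: (@initial_continuous _ _ (set_val : J -> _) p _ (nbhsx_ballx _ _ d0)).
apply: filterS pB => q [].
rewrite !ballEmdist /= !mdist_valued => /ltW pq0 /ltW pq1.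
apply: le_lt_trans Ne; apply: bisequence_dist_le => k kN.
have zpq : v (z p k - z q k) < v c.
  apply: le_lt_trans beta_lt.
  have <- : C ^+ N * (beta / C ^+ N) = beta.
    by rewrite mulrC divfK// gt_eqF// exprn_gt0.
  have kN' : - Posz N.+1 <= k <= Posz N by clear -kN; lia.
  exact: (orbit_expand b0 (ltW c1) (ltW bc) (zP p) (zP q) (zc p) (zc q)
    pq0 pq1 kN').
(* The term [z p k] is within [v c] of the centre given by its own sign and, through [z q k], of the
   centre given by the sign of [q]; so the signs coincide. *)
apply: (signed_inj v2 (le_lt_trans (itinP p k) beta_lt)).
rewrite -(subrKA (z q k)) absvD_lt//.
exact: le_lt_trans (itinP q k) beta_lt.
Qed.
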